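(* In the network slicing model described in the context, let the relative loads $(\tilde{\boldsymbol\rho}^v:v\in\mathcal V)$ be fixed and let $\rho^v\to\infty$ for all $v\in\mathcal V$. Then the overall weighted BTD gains of SCPF over SS and over GPS, $G_{\rm all}^{SS}$ and $G_{\rm all}^{GPS}$, tend respectively to $$G_{\rm all}^{SS,H}=\frac{\sum_{v\in\mathcal V}s^v\|\tilde{\boldsymbol\rho}^v\|_2^2}{\sum_{v\in\mathcal V}s^v\langle\tilde{\boldsymbol g},\tilde{\boldsymbol\rho}^v\rangle},\qquad G_{\rm all}^{GPS,H}=\frac{\sum_{v\in\mathcal V}s^v\|\tilde{\boldsymbol\rho}^v\|_{\boldsymbol I-\boldsymbol S^v}^2}{\sum_{v\in\mathcal V}s^v\langle\tilde{\boldsymbol g},\tilde{\boldsymbol\rho}^v\rangle},$$ where $\boldsymbol S^v$ is taken at its limiting value as all overall loads tend to infinity, and $$G_{\rm all}^{SS,H}\ge1,\qquad G_{\rm all}^{GPS,H}\ge1.$$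
   Context: Model. $\mathcal B$ (base stations) and $\mathcal V$ (slices) are finite nonempty sets. Each slice $v$ has a share $s^v>0$, with $\sum_{v\in\mathcal V}s^v=1$. The number $N_b^v$ of customers of slice $v$ at base station $b$ is Poisson with mean $\rho_b^v\ge 0$, and the variables $(N_b^v)_{b,v}$ are mutually independent. Put $N^v=\sum_b N_b^v$, $\rho^v=\sum_b\rho_b^v>0$ (overall load). Each customer $u$ of slice $v$ at base station $b$ has a peak rate $c_u>0$; the peak rates are independent of each other and of the counts, and $c_u$ is distributed as a random variable $C_b^v$ with $\delta_b^v:=\mathbb E[1/C_b^v]\in(0,\infty)$. Rates. When the counts are $n_b^v$ and $n^v=\sum_b n_b^v$, a customer $u$ of slice $v$ at base station $b$ receives rate: - Static Slicing (SS): $r_u^{SS}=\frac{s^v}{n_b^v}c_u$; - General Processor Sharing (GPS): $r_u^{GPS}=\frac{s^v}{n_b^v\sum_{w\in\mathcal V}s^{w}\mathbf 1_{\{n_b^{w}>0\}}}c_u$; - Share Constrained Proportionally Fair (SCPF): $r_u^{SCPF}=\frac{s^v/n^v}{\sum_{w\in\mathcal V:\,n^w>0}n_b^{w}s^{w}/n^{w}}c_u$. Mean bit transmission delay (BTD) of a typical customer of slice $v$ at base station $b$ (Palm expectation), for $\rho_b^v>0$: $\mathbb E^v[1/R_b^v]=\frac1{\rho_b^v}\mathbb E\big[\sum_{u\in\mathcal U_b^v}1/r_u^{SCPF}\big]$, where $\mathcal U_b^v$ is the set of the $N_b^v$ customers of slice $v$ at $b$; $\mathbb E^v[1/R_b^{v,SS}]$,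 $\mathbb E^v[1/R_b^{v,GPS}]$ likewise with $r_u^{SS}$, $r_u^{GPS}$. Normalized BTD. With $\tilde\rho_b^v=\rho_b^v/\rho^v$, $\tilde{\boldsymbol\rho}^v=(\tilde\rho_b^v)_b$, $$\bar{\mathbb E}^v\Big[\tfrac1{R_b^v}\Big]=\frac1{\delta_b^v}\frac{s^v}{\rho^v}\mathbb E^v\Big[\tfrac1{R_b^v}\Big],\qquad \bar{\mathbb E}^v\Big[\tfrac1{R^v}\Big]=\sum_{b\in\mathcal B}\tilde\rho_b^v\,\bar{\mathbb E}^v\Big[\tfrac1{R_b^v}\Big]$$ (terms with $\tilde\rho_b^v=0$ being $0$), and analogously $\bar{\mathbb E}^v[1/R^{v,SS}]$, $\bar{\mathbb E}^v[1/R^{v,GPS}]$. The overall weighted BTD gains are $$G_{\rm all}^{SS}=\frac{\sum_v s^v\bar{\mathbb E}^v[1/R^{v,SS}]}{\sum_v s^v\bar{\mathbb E}^v[1/R^{v}]},\qquad G_{\rm all}^{GPS}=\frac{\sum_v s^v\bar{\mathbb E}^v[1/R^{v,GPS}]}{\sum_v s^v\bar{\mathbb E}^v[1/R^{v}]}.$$ Notation. $\tilde{\boldsymbol g}=(\tilde g_b)_b$ with $\tilde g_b=\sum_{w\in\mathcal V}s^w\tilde\rho_b^w$; $\bar s_b^v=\sum_{w\ne v}s^{w}e^{-\rho_b^{w}}$; $\boldsymbol S^v=\mathrm{diag}(\bar s_b^v:b\in\mathcal B)$; $\boldsymbol I$ is the identity matrix; $\|\boldsymbol x\|_{\boldsymbol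 M}^2=\boldsymbol x^T\boldsymbol M\boldsymbol x$ for diagonal $\boldsymbol M$. *)

(* Defs.v *)
From HB Require Import structures.
From mathcomp Require Import all_boot all_order all_algebra.
From mathcomp Require Import all_classical all_reals all_analysis.

Set Implicit Arguments.
Unset Strict Implicit.
Unset Printing Implicit Defensive.

Import Order.TTheory GRing.Theory Num.Theory.
Import numFieldNormedType.Exports.

Local Open Scope classical_set_scope.
Local Open Scope ring_scope.

(* G j is meant to be a sub-sigma-algebra for every j; J may be infinite. *)
Definition mutually_independent (d : measure_display) (T : measurableType d)
    (R : realType) (P : probability T R) (J : eqType) (G : J -> set_system T)
    : Prop :=
  forall (r : seq J) (A : J -> set T), uniq r ->
    (forall j, j \in r -> G j (A j)) ->
    P (\big[setI/setT]_(j <- r) A j) = (\prod_(j <- r) P (A j))%E.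

Definition sigma_of (d d' : measure_display) (T : measurableType d)
    (T' : measurableType d') (X : T -> T') : set_system T :=
  preimage_set_system setT X measurable.

Section Loads.
Context {R : realType} {B V : finType}.
Implicit Types (s : V -> R) (rho : B -> V -> R).

Definition overall_load rho (v : V) : R := \sum_b rho b v.

Definition relative_load rho (b : B) (v : V) : R := rho b v / overall_load rho v.

Definition gtilde s (rhot : B -> V -> R) (b : B) : R := \sum_w s w * rhot b w.

Definition sbar s rho (b : B) (v : V) : R :=
  \sum_(w | w != v) s w * expR (- rho b w).

End Loads.

(* The rate of a customer of slice v at b with peak rate c, given all counts. *)
Definition policy (R : realType) (B V : finType) : Type :=
  (B -> V -> nat) -> B -> V -> R -> R.

Section Policies.
Context {R : realType} {B V : finType}.
Context (s : V -> R).

Definition slice_count (n : B -> V -> nat) (v : V) : nat := (\sum_b n b v)%N.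

Definition rateSS : policy R B V := fun n b v c => s v / (n b v)%:R * c.

Definition rateGPS : policy R B V := fun n b v c =>
  s v / ((n b v)%:R * \sum_w s w * (0 < n b w)%N%:R) * c.

Definition rateSCPF : policy R B V := fun n b v c =>
  (s v / (slice_count n v)%:R)
  / (\sum_(w | (0 < slice_count n w)%N)
       (n b w)%:R * s w / (slice_count n w)%:R) * c.

End Policies.

(* The customers of slice v at b are numbered from 0: peak b v k is the peak
   rate of the k-th one, and only the indices k < count b v are present.
   poisson_prob ignores its second argument, and poisson_prob 0 _ = \d_0. *)
Record slicing_model (R : realType) (B V : finType) (rho : B -> V -> R)
    (C : B -> V -> probability (measurableTypeR R) R) := SlicingModel {
  sm_display : measure_display;
  sm_space : measurableType sm_display;
  sm_prob : probability sm_space R;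
  count_rv : B -> V -> {mfun sm_space >-> nat};
  peak_rv : B -> V -> nat -> {mfun sm_space >-> measurableTypeR R};
  count_poisson : forall b v (A : set nat),
    distribution sm_prob (count_rv b v) A = poisson_prob (rho b v) 0%N A;
  peak_gt0 : forall b v k t, (0 : R) < peak_rv b v k t;
  peak_law : forall b v k (A : set (measurableTypeR R)), measurable A ->
    distribution sm_prob (peak_rv b v k) A = C b v A;
  counts_peaks_independent :
    mutually_independent sm_prob
      (fun j : (B * V) + (B * V * nat) =>
         match j with
         | inl (b, v) => sigma_of (count_rv b v)
         | inr (b, v, k) => sigma_of (peak_rv b v k)
         end)
}.

Section BTD.
Context {R : realType} {B V : finType}.
Context (s : V -> R) (rho : B -> V -> R).
Context (C : B -> V -> probability (measurableTypeR R) R).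
Local Open Scope ereal_scope.

(* C b v is the law of the generic peak rate C_b^v, so this is E[1/C_b^v]. *)
Definition delta (b : B) (v : V) : \bar R := \int[C b v]_x ((x : R)^-1)%:E.

Context (M : slicing_model rho C).

Definition total_delay (r : policy R B V) (b : B) (v : V) (t : sm_space M) : R :=
  (let n := fun b' v' => count_rv M b' v' t in
   \sum_(k < n b v) (r n b v (peak_rv M b v k t))^-1)%R.

(* Palm expectation: the total delay of the customers of v at b, averaged and
   divided by their mean number rho b v. *)
Definition mean_btd (r : policy R B V) (b : B) (v : V) : \bar R :=
  ((rho b v)^-1)%:E * 'E_(sm_prob M)[total_delay r b v].

Definition normalized_btd (r : policy R B V) (b : B) (v : V) : \bar R :=
  (delta b v)^-1 * (s v / overall_load rho v)%:E * mean_btd r b v.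

(* In \bar R, 0 * x = 0 for every x, so the terms with relative load 0 vanish. *)
Definition normalized_btd_slice (r : policy R B V) (v : V) : \bar R :=
  \sum_b (relative_load rho b v)%:E * normalized_btd r b v.

Definition overall_btd (r : policy R B V) : \bar R :=
  \sum_v (s v)%:E * normalized_btd_slice r v.

Definition gain_SS : \bar R :=
  overall_btd (rateSS s) / overall_btd (rateSCPF s).

Definition gain_GPS : \bar R :=
  overall_btd (rateGPS s) / overall_btd (rateSCPF s).

End BTD.

Section HeavyTraffic.
Context {R : realType} {B V : finType}.
Context (s : V -> R) (rhot : B -> V -> R).

Definition inner (x y : B -> R) : R := \sum_b x b * y b.

Definition sqnorm2 (x : B -> R) : R := \sum_b x b ^+ 2.

(* Vectors and matrices indexed by B, through the enumeration of B. *)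
Definition colv (x : B -> R) : 'cV[R]_#|B| := \col_i x (enum_val i).

Definition diagv (x : B -> R) : 'M[R]_#|B| := diag_mx (\row_i x (enum_val i)).

Definition sqnormM (M : 'M[R]_#|B|) (x : B -> R) : R :=
  ((colv x)^T *m M *m colv x) ord0 ord0.

Definition gain_SS_H : R :=
  (\sum_v s v * sqnorm2 (rhot ^~ v))
  / (\sum_v s v * inner (gtilde s rhot) (rhot ^~ v)).

(* sbarH b v stands for the limiting value of sbar. *)
Definition gain_GPS_H (sbarH : B -> V -> R) : R :=
  (\sum_v s v * sqnormM (1%:M - diagv (sbarH ^~ v)) (rhot ^~ v))
  / (\sum_v s v * inner (gtilde s rhot) (rhot ^~ v)).

End HeavyTraffic.

(* Main.v *)
(* In each of the three policies the inverse rate of a customer is h(N) / c,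
   where c is its own peak rate and N the vector of all counts.  Independence
   of N and the peak rates gives E[delay] = delta * E[N_b^v h(N)], so only means
   of functions of independent Poisson variables remain.  They all follow from
   the Mecke identity E[N_j f(N)] = rho_j E[f(N + e_j)].  For SCPF the crucial
   term is E[N_b^w / N^w; N^w > 0] = rho_b^w E[1 / (N^w + 1)]; summing over b
   identifies rho^w E[1 / (N^w + 1)] with P(N^w > 0) = 1 - exp(- rho^w).
   The overall BTDs are thus explicit functions of the loads, whose limits are
   read off.  Both lower bounds are the Cauchy-Schwarz inequality at each base
   station b: in the limit 1 - sbar_b^v is the total share of the slices
   present at b (when v is one of them). *)
Require Import Defs.
From mathcomp Require Import all_boot all_order all_algebra.
From mathcomp Require Import all_classical all_reals all_analysis.
From mathcomp Require Import ring.

Import Order.TTheory GRing.Theory Num.Theory.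
Import numFieldNormedType.Exports measurable_realfun.

Local Open Scope classical_set_scope.
Local Open Scope ring_scope.

(** At [r = 0] the law is the Dirac mass at 0, and the usual formula survives because [0 ^+ 0 = 1].
    Stations without load thus need no separate treatment. *)
Lemma poisson_prob_set1 (R : realType) (r : R) (k : nat) : 0 <= r ->
  poisson_prob r 0 [set k] = (r ^+ k * k`!%:R^-1 * expR (- r))%:E.
Proof.
rewrite le_eqVlt /poisson_prob => /predU1P[<-|r_gt0].
  rewrite ltxx oppr0 expR0 mulr1 diracE.
  case: k => [|k]; first by rewrite mem_set //= expr0 fact0 invr1 mulr1.
  by rewrite memNset //= expr0n mul0r.
by rewrite r_gt0 esum_set1 ?lee_fin ?poisson_pmf_ge0 // /poisson_pmf r_gt0.
Qed.

(** * Decomposition along the fibers of a countably-valued map *)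

Section CountableImage.
Context {R : realType} {d : measure_display} {T : measurableType d}.
Context (P : probability T R) {S : countType} (N : T -> S).
Context (mN : forall m, measurable (N @^-1` [set m])).
Local Open Scope ereal_scope.

(** Countable additivity is available along sequences, so the fibers are renumbered by [pickle]; a
    number that codes no value gets an empty cell. *)
Let cell (k : nat) : set T := [set t | pickle (N t) = k].

Let mcell k : measurable (cell k).
Proof.
rewrite /cell; case E : (@pickle_inv S k) => [m|].
  rewrite (_ : [set t | _] = N @^-1` [set m]) //; apply/seteqP; split => t /=.
    by move=> tk; move: E; rewrite -tk pickleK_inv => -[].
  by move=> ->; have := @pickle_invK S k; rewrite E.
rewrite (_ : [set t | _] = set0) //; apply/seteqP; split => t //= tk.
by move: E; rewrite -tk pickleK_inv.
Qed.

Let cell_cover : \bigcup_k cell k = setT.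
Proof. by apply/seteqP; split => // t _; exists (pickle (N t)). Qed.

Lemma measurable_fun_fibers d' (T' : sigmaRingType d') (f : T -> T') :
  (forall m, measurable_fun (N @^-1` [set m]) f) -> measurable_fun setT f.
Proof.
move=> mf; rewrite -cell_cover; apply/measurable_fun_bigcup => // k.
case: (pselect (exists t, cell k t)) => [[t tk]|kN]; last first.
  rewrite (_ : cell k = set0); first exact: measurable_fun_set0.
  by apply/seteqP; split => t //= tk; apply: kN; exists t.
rewrite (_ : cell k = N @^-1` [set N t]) //.
apply/seteqP; split => u; rewrite /cell /= -tk; first exact: (pcan_inj pickleK).
by move=> ->.
Qed.

Lemma ge0_integral_fibers (f : T -> \bar R) :
  (forall t, 0 <= f t) -> measurable_fun setT f ->
  \int[P]_t f t = \esum_(m in [set: S]) \int[P]_(t in N @^-1` [set m]) f t.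
Proof.
move=> f0 mf; rewrite -{1}cell_cover ge0_integral_bigcup //; last first.
- by move=> i j _ _ [t [/= <- <-]].
- by rewrite cell_cover.
rewrite nneseries_esumT => [|k]; last exact: integral_ge0.
transitivity (\esum_(k in range (@pickle S)) \int[P]_(t in cell k) f t); last first.
  rewrite esum_image; last by move=> x y _ _; exact: (pcan_inj pickleK).
  apply: eq_esum => m _; congr (\int[P]_(t in _) f t).
  apply/seteqP; split => t; rewrite /cell /=; first exact: (pcan_inj pickleK).
  by move=> ->.
rewrite [RHS]esum_mkcond; apply: eq_esum => k _; case: ifPn => // /negP kN.
rewrite (_ : cell k = set0) ?integral_set0 //.
by apply/seteqP; split => t //= tk; apply: kN; rewrite inE; exists (N t).
Qed.

End CountableImage.

(** * Means of functions of independent Poisson counts *)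

Definition incr {J : finType} (j : J) (m : {ffun J -> nat}) : {ffun J -> nat} :=
  [ffun k => (m k + (k == j))%N].

Lemma fiber_ffun {T : Type} {J : finType} (N : T -> {ffun J -> nat}) m :
  N @^-1` [set m] = [set t | forall j, [set m j] (N t j)].
Proof. by apply/seteqP; split => t /=; [move=> -> | move=> /ffunP]. Qed.

Definition total_count {J : finType} (S : {set J}) (m : {ffun J -> nat}) : nat :=
  (\sum_(j in S) m j)%N.

Definition mean {R : realType} {d : measure_display} {T : measurableType d}
    (P : probability T R) {S : Type} (N : T -> S) (phi : S -> R) : \bar R :=
  (\int[P]_t (phi (N t))%:E)%E.

Section PoissonField.
Context {R : realType} {d : measure_display} {T : measurableType d}.
Context {P : probability T R} {J : finType} {N : T -> {ffun J -> nat}}.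
Context {rho : J -> R}.
Context (rho_ge0 : forall j, 0 <= rho j).
Context (mN : forall m, measurable (N @^-1` [set m])).
Context (lawN : forall A : J -> set nat,
  P [set t | forall j, A j (N t j)] = (\prod_j poisson_prob (rho j) 0 (A j))%E).
Implicit Types (phi psi : {ffun J -> nat} -> R) (m : {ffun J -> nat}) (j : J).

Local Notation Ex := (mean P N).

Let mphi phi : measurable_fun setT (fun t => (phi (N t))%:E).
Proof.
apply: (measurable_fun_fibers _ mN) => m.
apply: (eq_measurable_fun (cst (phi m)%:E)) => [t /[!inE] /= -> //|].
exact: measurable_cst.
Qed.

Lemma fiber_prob m :
  P (N @^-1` [set m]) =
  (\prod_j (rho j ^+ m j * (m j)`!%:R^-1 * expR (- rho j)))%:E.
Proof.
rewrite fiber_ffun (lawN (fun j => [set m j])) -prodEFin.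
by apply: eq_bigr => j _; rewrite poisson_prob_set1.
Qed.

Lemma mean_esum phi : (forall m, 0 <= phi m) ->
  Ex phi = \esum_(m in setT) ((phi m)%:E * P (N @^-1` [set m]))%E.
Proof.
move=> phi0; rewrite /mean (ge0_integral_fibers _ _ mN) //; last first.
  by move=> t; rewrite lee_fin.
apply: eq_esum => m _; rewrite -integral_cst //.
by apply: eq_integral => t /[!inE] /= ->.
Qed.

Lemma mean_ext phi psi : (forall m, phi m = psi m) -> Ex phi = Ex psi.
Proof. by move=> e; apply: eq_integral => t _; rewrite e. Qed.

Lemma meanD phi psi : (forall m, 0 <= phi m) -> (forall m, 0 <= psi m) ->
  (Ex (fun m => (phi m + psi m)%R) = Ex phi + Ex psi)%E.
Proof.
by move=> phi0 psi0; rewrite -ge0_integralD // => t _; rewrite lee_fin.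
Qed.

Lemma meanZ (c : R) phi : 0 <= c -> (forall m, 0 <= phi m) ->
  (Ex (fun m => (c * phi m)%R) = c%:E * Ex phi)%E.
Proof.
by move=> c0 phi0; rewrite -ge0_integralZl_EFin // => t _; rewrite lee_fin.
Qed.

Lemma mean1 : (Ex (fun=> 1%R) = 1)%E.
Proof. by rewrite /mean integral_cst // mul1e; exact: probability_setT. Qed.

Lemma mean_sum (K : finType) (Q : pred K) (phi : K -> {ffun J -> nat} -> R) :
  (forall k m, 0 <= phi k m) ->
  (Ex (fun m => (\sum_(k | Q k) phi k m)%R) = \sum_(k | Q k) Ex (phi k))%E.
Proof.
move=> phi0; rewrite /mean.
under eq_integral do rewrite -sumEFin -big_filter.
rewrite (@ge0_integral_sum _ _ _ _ _ measurableT _ (fun k t => (phi k (N t))%:E)).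
- by rewrite big_filter.
- by move=> k; exact: (mphi (phi k)).
- by move=> k t _; rewrite lee_fin.
Qed.

Lemma mean_lincomb (K : finType) (Q : pred K) (c x : K -> R)
    (phi : K -> {ffun J -> nat} -> R) :
  (forall k, 0 <= c k) -> (forall k m, 0 <= phi k m) ->
  (forall k, Q k -> Ex (phi k) = (x k)%:E) ->
  Ex (fun m => \sum_(k | Q k) c k * phi k m) = (\sum_(k | Q k) c k * x k)%:E.
Proof.
move=> c0 phi0 Exphi; rewrite mean_sum => [|k m]; last by rewrite mulr_ge0.
by rewrite -sumEFin; apply: eq_bigr => k Qk; rewrite EFinM -Exphi // meanZ.
Qed.

(** The event is a product event, with factor [{0}] over [S] and no constraint elsewhere, so [lawN]
    turns its probability into a product of exponentials. *)
Lemma mean_all_zero (S : {set J}) :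
  Ex (fun m => [forall j in S, m j == 0%N]%:R) =
  (expR (- \sum_(j in S) rho j))%:E.
Proof.
pose z m := [forall j in S, m j == 0%N].
have mA : measurable [set t | z (N t)].
  rewrite -[X in measurable X]setTI.
  apply: (measurable_fun_fibers _ mN _ bool (z \o N)) => // m.
  apply: (eq_measurable_fun (cst (z m))) => [t /[!inE] /= -> //|].
  exact: measurable_cst.
transitivity (P [set t | z (N t)]).
  rewrite -[RHS]mul1e -[RHS]integral_cst // integral_mkcond.
  apply: eq_integral => t _; rewrite patchE -/(z (N t)).
  case: (boolP (z (N t))) => zt; first by rewrite mem_set.
  by rewrite memNset //=; exact/negP.
rewrite (_ : [set t | _] =
  [set t | forall j, (if j \in S then [set 0%N] else setT) (N t j)]); last first.
  apply/seteqP; split => t /=.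
    by move=> /forall_inP N0 j; case: ifPn => // /N0/eqP.
  by move=> N0; apply/forall_inP => j jS; have := N0 j; rewrite jS => ->.
rewrite (lawN (fun j => if j \in S then [set 0%N] else setT)).
rewrite raddf_sum expR_sum -prodEFin [RHS]big_mkcond; apply: eq_bigr => j _.
case: ifPn => _; last exact: probability_setT.
by rewrite poisson_prob_set1 // expr0 fact0 invr1 !mul1r.
Qed.

(** The two complementary indicators add up to 1; this sum being finite, the mean from
    [mean_all_zero] can be subtracted in the extended reals. *)
Lemma mean_some_pos (S : {set J}) :
  Ex (fun m => 1 - [forall j in S, m j == 0%N]%:R) =
  (1 - expR (- \sum_(j in S) rho j))%:E.
Proof.
pose q m : R := 1 - [forall j in S, m j == 0%N]%:R.
have q0 m : 0 <= q m by rewrite /q; case: forallP => _; rewrite ?subrr ?subr0.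
have : (Ex q + (expR (- \sum_(j in S) rho j))%:E = 1)%E.
  by rewrite -mean_all_zero -meanD // -mean1; apply: mean_ext => m; rewrite /q subrK.
by case: (Ex q) => //= r [<-]; rewrite addrK.
Qed.

(** In the coordinate [j] this is k r^k / k! = r r^(k-1) / (k-1)!, after a shift of the summation
    index; the other factors of the weight are untouched. *)
Lemma mecke j phi : (forall m, 0 <= phi m) ->
  (Ex (fun m => ((m j)%:R * phi m)%R) = (rho j)%:E * Ex (fun m => phi (incr j m)))%E.
Proof.
move=> phi0; rewrite -meanZ // !mean_esum //; last 2 first.
- by move=> m; rewrite mulr_ge0.
- by move=> m; rewrite mulr_ge0.
have incr_inj : injective (incr j).
  move=> m m' /ffunP e; apply/ffunP => k; have := e k.
  by rewrite !ffunE => /addIn.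
(* Outside the range of [incr j] the count at [j] is 0, and so is the summand. *)
transitivity (\esum_(m in range (incr j))
    ((m j)%:R * phi m)%:E * P (N @^-1` [set m]))%E.
  rewrite [RHS]esum_mkcond; apply: eq_esum => m _; case: ifPn => // /negP mj.
  suff -> : m j = 0%N by rewrite mul0r mul0e.
  apply/eqP; rewrite -leqn0 leqNgt; apply/negP => mj0; apply: mj; rewrite inE.
  exists [ffun k => (m k - (k == j))%N] => //; apply/ffunP => k; rewrite !ffunE.
  by case: eqP => [->|]; rewrite ?subnK ?subn0 ?addn0.
rewrite esum_image; last by move=> m m' _ _; exact: incr_inj.
apply: eq_esum => m _; rewrite !fiber_prob -!EFinM; congr EFin.
rewrite (bigD1 j) //= [in RHS](bigD1 j) //= !ffunE eqxx addn1.
under eq_bigr => k kj do rewrite ffunE (negbTE kj) addn0.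
rewrite exprS factS natrM.
have : ((m j).+1%:R : R) != 0 by rewrite pnatr_eq0.
have : ((m j)`!%:R : R) != 0 by rewrite pnatr_eq0 -lt0n fact_gt0.
set a := (_`!)%:R; set b := _.+1%:R; set c := \prod_(_ | _) _ => a0 b0.
by clearbody a b c; field; rewrite a0.
Qed.

Lemma mean_count j phi : (forall m, 0 <= phi m) ->
  (forall m, phi (incr j m) = phi m) ->
  (Ex (fun m => ((m j)%:R * phi m)%R) = (rho j)%:E * Ex phi)%E.
Proof.
by move=> phi0 phij; rewrite mecke //; congr (_ * _)%E; exact: mean_ext.
Qed.

(** Two uses of the Mecke identity give the Poisson second moment; [phi], which does not see the
    count at [j], factors out. *)
Lemma mean_count_sqr j phi : (forall m, 0 <= phi m) ->
  (forall m, phi (incr j m) = phi m) ->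
  (Ex (fun m => ((m j)%:R * ((m j)%:R * phi m))%R) =
   (rho j * (rho j + 1))%:E * Ex phi)%E.
Proof.
move=> phi0 phij; rewrite mecke; last by move=> m; rewrite mulr_ge0.
rewrite (@mean_ext _ (fun m => (m j)%:R * phi m + phi m)); last first.
  by move=> m; rewrite phij ffunE eqxx natrD mulrDl mul1r.
rewrite meanD // => [|m]; last by rewrite mulr_ge0.
rewrite mean_count // EFinM -muleA EFinD ge0_muleDl ?mul1e ?lee_fin //.
Qed.

Context (S : {set J}).
Local Notation tot := (total_count S).

Lemma total_count_incr j m : tot (incr j m) = (tot m + (j \in S))%N.
Proof.
rewrite /total_count; under eq_bigr do rewrite ffunE.
rewrite big_split /=; congr addn; have [jS|jS] := boolP (j \in S).
  by rewrite (bigD1 j) //= eqxx big1 ?addn0 // => k /andP[_ /negbTE ->].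
by rewrite big1 // => k kS; case: eqP => // kj; rewrite -kj kS in jS.
Qed.

(** [mecke] at [j] raises the total by one. The extra one contributes [Ex phi], and the old total is
    a sum of counts handled by [mean_count]. *)
Lemma mean_count_tot j phi : j \in S -> (forall m, 0 <= phi m) ->
  (forall k m, k \in S -> phi (incr k m) = phi m) ->
  (Ex (fun m => ((m j)%:R * ((tot m)%:R * phi m))%R) =
   (rho j * (\sum_(k in S) rho k + 1))%:E * Ex phi)%E.
Proof.
move=> jS phi0 phiS; rewrite mecke => [|m]; last by rewrite mulr_ge0.
rewrite EFinM -muleA; congr (_ * _)%E.
rewrite (@mean_ext _ (fun m => (\sum_(k in S) (m k)%:R * phi m) + phi m)); last first.
  move=> m; rewrite phiS // total_count_incr jS.
  by rewrite -mulr_suml -natr_sum natrD mulrDl mul1r.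
rewrite meanD // => [|m]; last by apply: sumr_ge0 => k _; rewrite mulr_ge0.
have -> : (Ex (fun m => \sum_(k in S) (m k)%:R * phi m)%R =
    (\sum_(k in S) rho k)%:E * Ex phi)%E.
  rewrite mean_sum => [|k m]; last by rewrite mulr_ge0.
  rewrite -sumEFin ge0_sume_distrl //; last by move=> k _; rewrite lee_fin.
  apply: eq_bigr => k kS; apply: mean_count => // m; exact: phiS.
by rewrite EFinD ge0_muleDl ?mul1e ?lee_fin //; exact: sumr_ge0.
Qed.

(* The fraction is [0 / 0 = 0] when all counts in [S] vanish. *)
Lemma mean_fraction j : j \in S -> 0 < \sum_(k in S) rho k ->
  Ex (fun m => (m j)%:R / (tot m)%:R) =
  (rho j / (\sum_(k in S) rho k) * (1 - expR (- \sum_(k in S) rho k)))%:E.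
Proof.
move=> jS rS.
(* The increment turns the denominator into [tot + 1] for every [k] in [S], so all fractions share
   one unknown factor, which their sum will determine. *)
have fracE k : k \in S ->
    (Ex (fun m => ((m k)%:R / (tot m)%:R)%R) =
     (rho k)%:E * Ex (fun m => (tot m + 1)%:R^-1%R))%E.
  move=> kS; rewrite mecke //.
  by congr (_ * _)%E; apply: mean_ext => m; rewrite total_count_incr kS.
have totN0 m : (\sum_(k in S) (m k)%:R / (tot m)%:R)%R =
    1 - [forall k in S, m k == 0%N]%:R :> R.
  rewrite -mulr_suml -natr_sum -/(total_count S m) -sum_nat_eq0 -/(total_count S m).
  have [->|t0] := eqVneq (tot m) 0%N; first by rewrite mul0r subrr.
  by rewrite divff ?subr0 ?pnatr_eq0.
have : (\sum_(k in S) Ex (fun m => ((m k)%:R / (tot m)%:R)%R) =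
    (1 - expR (- \sum_(k in S) rho k))%:E)%E.
  rewrite -mean_sum => [|k m]; last by rewrite divr_ge0.
  by rewrite -mean_some_pos; apply: mean_ext => m; exact: totN0.
under eq_bigr => k kS do rewrite fracE //.
rewrite -ge0_sume_distrl; last by move=> k _; rewrite lee_fin.
rewrite fracE // sumEFin.
(* An infinite factor times the positive total load would be infinite, against the finite value of
   the sum. *)
case: (Ex _) => [r| |] //=.
- rewrite -!EFinM => -[<-]; congr EFin; field; exact: lt0r_neq0.
- by rewrite mulry gtr0_sg // mul1e.
- by rewrite mulrNy gtr0_sg // mul1e.
Qed.

End PoissonField.

(** * Integrals of a variable independent of an event *)

Section IndependentIntegral.
Context {R : realType} {d d' : measure_display}.
Context {T : measurableType d} {T' : measurableType d'}.
Context (P : probability T R) (X : {mfun T >-> T'}) (C : probability T' R).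
Local Open Scope ereal_scope.

(** The restricted measure agrees with [P] inside [E] and is null outside. Moving [E] from the
    domain into the measure prepares a change of variables on the whole space. *)
Lemma integral_mrestr (E : set T) (mE : measurable E) (f : T -> \bar R) :
  measurable_fun setT f -> (forall t, 0 <= f t) ->
  \int[mrestr P mE]_t f t = \int[P]_(t in E) f t.
Proof.
move=> mf f0; have mEC := measurableC mE.
rewrite -(setUv E) ge0_integral_setU ?setUv //; last exact/disj_setPCl.
rewrite (@eq_measure_integral _ _ _ _ P) => [|A mA AE]; last first.
  by rewrite /= /mrestr setIidl.
rewrite (@eq_measure_integral _ _ _ (~` E) mzero) => [|A mA AE].
  by rewrite integral_measure_zero adde0.
rewrite /= /mrestr (_ : A `&` E = set0) ?measure0 //.
by apply/seteqP; split => t //= [/AE].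
Qed.

(** By independence, the image under [X] of [P] restricted to [E] is the measure [C] scaled by
    [P E]. *)
Lemma ge0_integral_indep (E : set T) (f : T' -> \bar R) : measurable E ->
  (forall A, measurable A -> P (E `&` X @^-1` A) = P E * C A) ->
  measurable_fun setT f -> (forall y, 0 <= f y) ->
  \int[P]_(t in E) f (X t) = P E * \int[C]_y f y.
Proof.
move=> mE indep mf f0.
have mX : measurable_fun setT X by exact: measurable_funPT.
rewrite -(integral_mrestr E mE); last 2 first.
- exact: measurableT_comp.
- by [].
rewrite -(@ge0_integral_pushforward _ _ _ _ _ _ mX (mrestr P mE) setT f) //.
have PE0 : (0 <= fine (P E))%R by rewrite fine_ge0.
have PEfin : P E \is a fin_num by exact: fin_num_measure.
rewrite (@eq_measure_integral _ _ _ _ (mscale (NngNum PE0) C)).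
  by rewrite ge0_integral_mscale //= fineK.
move=> A mA _; transitivity (P (X @^-1` A `&` E)) => [//|].
rewrite setIC indep // -[in LHS](fineK PEfin); reflexivity.
Qed.

(* [f] may be negative off the range of [X], as the inverse is on R. *)
Lemma integral_indep (E : set T) (f : T' -> \bar R) : measurable E ->
  (forall A, measurable A -> distribution P X A = C A) ->
  (forall A, measurable A -> P (E `&` X @^-1` A) = P E * C A) ->
  measurable_fun setT f -> (forall t, 0 <= f (X t)) ->
  \int[P]_(t in E) f (X t) = P E * \int[C]_y f y.
Proof.
move=> mE law indep mf fX0.
(* With the whole space as event, this integral is carried back to [T], where the negative part of
   [f (X t)] vanishes. *)
have neg0 : \int[C]_y f^\- y = 0.
  have PT : P setT = 1 by exact: probability_setT.
  rewrite -[LHS]mul1e -[X in X * _]PT -ge0_integral_indep //; last 2 first.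
  - by move=> A mA; rewrite setTI PT mul1e -law.
  - exact: measurable_funeneg.
  by apply: integral0_eq => t _; rewrite funenegE max_r // oppe_le0.
rewrite [in RHS]integralE neg0 sube0 -ge0_integral_indep //; last first.
  exact: measurable_funepos.
by apply: eq_integral => t _; rewrite funeposE max_l.
Qed.

End IndependentIntegral.

(** The inverse is continuous on the open complement of 0, and on the remaining point it is
    constant. *)
Lemma measurable_inv (R : realType) : measurable_fun setT (@GRing.inv R).
Proof.
rewrite -(setUv [set 0]); apply/measurable_funU => //.
  exact: measurableC.
split.
  apply: (eq_measurable_fun (cst (0 : R))) => [x /[!inE] /= ->|].
    by rewrite invr0.
  exact: measurable_cst.
apply: open_continuous_measurable_fun.
  by apply: closed_openC; exact: closed_eq.
by move=> x; rewrite inE /= => /eqP; exact: inv_continuous.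
Qed.

(** * Separating peak rates from counts in the mean delay *)

Section Model.
Context {R : realType} {B V : finType} {rho : B -> V -> R}.
Context {C : B -> V -> probability (measurableTypeR R) R}.
Context (M : slicing_model rho C).
Local Notation P := (sm_prob M).

(** A finite function over pairs has a countable type, so the fiber decomposition applies to all
    counts at once. *)
Definition counts (t : sm_space M) : {ffun B * V -> nat} :=
  [ffun j => count_rv M j.1 j.2 t].

Let countsE (A : B * V -> set nat) :
  [set t | forall j, A j (counts t j)] =
  \big[setI/setT]_(j : B * V) (count_rv M j.1 j.2 @^-1` A j).
Proof.
rewrite -(bigcap_seq (index_enum _)).
apply/seteqP; split => t /= At j; have := At j; rewrite ffunE //.
by apply; rewrite /= mem_index_enum.
Qed.

Lemma measurable_counts (A : B * V -> set nat) :
  measurable [set t | forall j, A j (counts t j)].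
Proof.
rewrite countsE; apply: bigsetI_measurable => j _.
by rewrite -[X in measurable X]setTI; exact: measurable_funPT.
Qed.

Lemma measurable_counts_fiber m : measurable (counts @^-1` [set m]).
Proof. by rewrite fiber_ffun; exact: (measurable_counts (fun j => [set m j])). Qed.

Lemma counts_law (A : B * V -> set nat) :
  P [set t | forall j, A j (counts t j)] =
  (\prod_j poisson_prob (rho j.1 j.2) 0 (A j))%E.
Proof.
rewrite countsE.
have := @counts_peaks_independent _ _ _ _ _ M (map inl (index_enum _))
  (fun j => if j is inl i then count_rv M i.1 i.2 @^-1` A i else setT).
rewrite !big_map => ->.
- by apply: eq_bigr => j _; rewrite -(count_poisson M).
- by rewrite map_inj_uniq ?index_enum_uniq // => i j [].
- by move=> _ /mapP[[b v] _ ->]; exists (A (b, v)); rewrite ?setTI.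
Qed.

(** Mutual independence is applied to the finite family made of one peak rate and all the counts. *)
Lemma counts_peak_indep m b v k (A : set (measurableTypeR R)) : measurable A ->
  P (counts @^-1` [set m] `&` peak_rv M b v k @^-1` A) =
  (P (counts @^-1` [set m]) * C b v A)%E.
Proof.
move=> mA; rewrite fiber_ffun (counts_law (fun j => [set m j])) (countsE (fun j => [set m j])).
have := @counts_peaks_independent _ _ _ _ _ M (inr (b, v, k) :: map inl (index_enum _))
  (fun j => match j with
    | inl i => count_rv M i.1 i.2 @^-1` [set m i]
    | inr _ => peak_rv M b v k @^-1` A end).
rewrite !big_cons !big_map setIC muleC => ->.
- rewrite -(peak_law M b v k) //; congr (_ * _)%E.
  by apply: eq_bigr => j _; rewrite -(count_poisson M).
- rewrite /= map_inj_uniq ?index_enum_uniq ?andbT => [|i j [] //].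
  by apply/negP => /mapP[].
- move=> j; rewrite inE => /orP[/eqP ->|/mapP[[b' v'] _ ->]].
    by exists A; rewrite ?setTI.
  by exists [set m (b', v')]; rewrite ?setTI.
Qed.

Lemma integral_fiber_peak m b v k :
  (\int[P]_(t in counts @^-1` [set m]) ((peak_rv M b v k t)^-1)%:E =
   P (counts @^-1` [set m]) * delta C b v)%E.
Proof.
apply: (integral_indep P (peak_rv M b v k) (C b v) _ (fun x => (x^-1)%:E)).
- exact: measurable_counts_fiber.
- by move=> A mA; rewrite peak_law.
- by move=> A mA; rewrite counts_peak_indep.
- by apply/measurable_EFinP; exact: measurable_inv.
- by move=> t; rewrite lee_fin invr_ge0 ltW ?peak_gt0.
Qed.

(** On a fiber of [counts] the random number of customers and the factor [h] are constants, and each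
    customer contributes [h] times [delta] times the probability of the fiber. Summing over fibers
    rebuilds the mean on the right. *)
Lemma mean_total_delay (r : policy R B V) (h : (B -> V -> nat) -> R) b v :
  (forall n, 0 <= h n) -> (forall n c, (r n b v c)^-1 = h n / c) ->
  (0 < delta C b v)%E -> (delta C b v < +oo)%E ->
  ('E_P[total_delay r b v] =
  delta C b v *
   mean P counts (fun m => ((m (b, v))%:R * h (fun b v => m (b, v)))%R))%E.
Proof.
move=> h0 rE d0 doo; have mF := measurable_counts_fiber.
have dfin : delta C b v \is a fin_num by rewrite ge0_fin_numE // ltW.
pose H m := h (fun b v => m (b, v)).
have H0 m : 0 <= H m by exact: h0.
have countE t : (fun b v => count_rv M b v t) = (fun b v => counts t (b, v)).
  by apply/funext => b'; apply/funext => v'; rewrite ffunE.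
have delayE t : (total_delay r b v t)%:E =
    (\sum_(k < counts t (b, v)) (H (counts t))%:E * ((peak_rv M b v k t)^-1)%:E)%E.
  rewrite /total_delay /= countE -sumEFin ffunE; apply: eq_bigr => k _.
  by rewrite rE EFinM.
have minv k : measurable_fun setT (fun t => ((peak_rv M b v k t)^-1)%:E).
  apply/measurable_EFinP; apply: measurableT_comp; first exact: measurable_inv.
  exact: measurable_funPT.
have inv0 k t : (0 <= ((peak_rv M b v k t)^-1)%:E)%E.
  by rewrite lee_fin invr_ge0 ltW ?peak_gt0.
rewrite unlock (ge0_integral_fibers _ _ mF); last 2 first.
- move=> t; rewrite delayE; apply: sume_ge0 => k _.
  by rewrite mule_ge0 // lee_fin.
- apply: (measurable_fun_fibers _ mF) => m.
  apply: (eq_measurable_fun (fun t =>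
    \sum_(k < m (b, v)) (H m)%:E * ((peak_rv M b v k t)^-1)%:E)%E).
    by move=> t /[!inE] /= <-; rewrite delayE.
  apply: emeasurable_sum => k; apply: measurable_funeM.
  exact: measurable_funTS.
have fd0 : 0 <= fine (delta C b v) by rewrite fine_ge0 // ltW.
have H'0 m : 0 <= (m (b, v))%:R * H m by rewrite mulr_ge0.
rewrite -(fineK dfin) -(meanZ mF) // (mean_esum mF) => [|m]; last first.
  by rewrite mulr_ge0.
apply: eq_esum => m _.
transitivity (\sum_(k < m (b, v))
    (H m)%:E * (P (counts @^-1` [set m]) * delta C b v))%E.
  transitivity (\int[P]_(t in counts @^-1` [set m])
      \sum_(k < m (b, v)) (H m)%:E * ((peak_rv M b v k t)^-1)%:E)%E.
    by apply: eq_integral => t /[!inE] /= <-; rewrite delayE.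
  rewrite ge0_integral_sum //; last 2 first.
  - move=> k; apply: measurable_funeM; exact: measurable_funTS.
  - by move=> k t _; rewrite mule_ge0 // lee_fin.
  apply: eq_bigr => k _; rewrite ge0_integralZl_EFin //.
    by rewrite integral_fiber_peak.
  exact: measurable_funTS.
have pfin : P (counts @^-1` [set m]) \is a fin_num by exact: fin_num_measure.
rewrite -(fineK dfin) -(fineK pfin) -!EFinM sumEFin; congr EFin.
by rewrite sumr_const card_ord -mulr_natl /H; ring.
Qed.

End Model.

(** * Mean total delays under the three policies *)

Section PolicyMeans.
Context {R : realType} {B V : finType} {s : V -> R} {rho : B -> V -> R}.
Context {C : B -> V -> probability (measurableTypeR R) R}.
Context (s_gt0 : forall v, 0 < s v).
Context (s_sum1 : \sum_v s v = 1).
Context (delta_gt0 : forall b v, (0 < delta C b v)%E).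
Context (delta_fin : forall b v, (delta C b v < +oo)%E).
Context (rho_ge0 : forall b v, 0 <= rho b v).
Context (load_gt0 : forall v, 0 < overall_load rho v).
Context (M : slicing_model rho C).
Local Notation P := (sm_prob M).
Local Notation Ex := (mean P (counts M)).

Let s_neq0 v : s v != 0. Proof. exact: lt0r_neq0. Qed.
Let s_ge0 v : 0 <= s v. Proof. exact: ltW. Qed.
Let mN := measurable_counts_fiber M.
Let lawN := counts_law M.
Let rhop (j : B * V) := rho j.1 j.2.
Let rhop_ge0 j : 0 <= rhop j. Proof. exact: rho_ge0. Qed.

Definition slice_set (v : V) : {set B * V} := [set j | j.2 == v].

Lemma sum_slice_set (G : nmodType) (F : B * V -> G) v :
  \sum_(j in slice_set v) F j = \sum_b F (b, v).
Proof.
transitivity (\sum_b \sum_(w | w == v) F (b, w)).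
  rewrite pair_big_dep /=; apply: eq_big => [[b w]|[b w] _] //.
  by rewrite inE.
by apply: eq_bigr => b _; rewrite big_pred1_eq.
Qed.

Lemma total_count_slice_set (m : {ffun B * V -> nat}) v :
  total_count (slice_set v) m = slice_count (fun b v => m (b, v)) v.
Proof. exact: (sum_slice_set nat). Qed.

(** The inverse rate is proportional to N_b^v, so adding it over N_b^v customers leaves a second
    moment. *)
Lemma total_delay_SS b v :
  ('E_P[total_delay (rateSS s) b v] =
   delta C b v * (rho b v * (rho b v + 1) / s v)%:E)%E.
Proof.
rewrite (mean_total_delay M _ (fun n => (n b v)%:R / s v)) //; last 2 first.
- by move=> n; rewrite divr_ge0.
- by move=> n c; rewrite /rateSS invfM invf_div.
congr (_ * _)%E; rewrite (mean_count_sqr rhop_ge0 mN lawN (b, v) (fun=> (s v)^-1)) //.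
  rewrite (_ : (fun=> _) = (fun _ => ((s v)^-1 * 1))); last by rewrite mulr1.
  by rewrite (meanZ mN) // ?mean1 ?mule1 // invr_ge0.
by move=> m; rewrite invr_ge0.
Qed.

Lemma total_delay_GPS b v :
  ('E_P[total_delay (rateGPS s) b v] =
   delta C b v * (rho b v * (rho b v + 1) / s v * (1 - sbar s rho b v))%:E)%E.
Proof.
rewrite (mean_total_delay M _
  (fun n => (n b v)%:R * (\sum_w s w * (0 < n b w)%N%:R) / s v)) //; last 2 first.
- move=> n; rewrite divr_ge0 // mulr_ge0 // sumr_ge0 // => w _.
  by rewrite mulr_ge0.
- by move=> n c; rewrite /rateGPS invfM invf_div.
congr (_ * _)%E.
(* The indicator of slice [v] itself is replaced by 1. The factor N_b^v hides the change, and [phi]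
   becomes insensitive to the count at [(b, v)]. *)
pose psi w (m : {ffun B * V -> nat}) : R :=
  if w == v then 1 else (0 < m (b, w))%N%:R.
pose x w : R := if w == v then 1 else 1 - expR (- rho b w).
pose phi m := \sum_w s w / s v * psi w m.
have psi0 w m : 0 <= psi w m by rewrite /psi; case: ifP.
have c0 w : 0 <= s w / s v by rewrite divr_ge0.
have phi0 m : 0 <= phi m by apply: sumr_ge0 => w _; rewrite mulr_ge0.
have phi_incr m : phi (incr (b, v) m) = phi m.
  apply: eq_bigr => w _; rewrite /psi; case: eqP => // /eqP wv.
  by rewrite ffunE xpair_eqE eqxx (negbTE wv) addn0.
have mean_phi : Ex phi = ((1 - sbar s rho b v) / s v)%:E.
  rewrite (mean_lincomb mN _ _ _ x) // => [|w _].
    congr EFin; rewrite [in RHS]/sbar -s_sum1.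
    rewrite (bigD1 v) //= [in RHS](bigD1 v) //= {1}/x eqxx mulr1.
    rewrite -addrA -sumrB mulrDl mulr_suml; congr (_ + _).
    apply: eq_bigr => w wv; rewrite /x (negbTE wv); ring.
  rewrite /psi /x; case: eqP => [_|_]; first exact: mean1.
  have := mean_some_pos rhop_ge0 mN lawN [set (b, w)].
  rewrite big_set1 => <-; apply: mean_ext => m.
  have -> : [forall j in [set (b, w)]%SET, m j == 0%N] = (m (b, w) == 0%N).
    apply/forall_inP/idP => [/(_ (b, w))|m0 j]; last by rewrite inE => /eqP ->.
    by apply; rewrite inE.
  by rewrite lt0n; case: eqP => _; rewrite ?subrr ?subr0.
rewrite (mean_ext _ (fun m => (m (b, v))%:R * ((m (b, v))%:R * phi m))).
  rewrite (mean_count_sqr rhop_ge0 mN lawN) // mean_phi -EFinM; congr EFin.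
  by rewrite /rhop /=; ring.
move=> m; have [->|mbv] := eqVneq (m (b, v)) 0%N; first by rewrite !mul0r.
congr (_ * _); rewrite -mulrA; congr (_ * _); rewrite mulr_suml.
apply: eq_bigr => w _; rewrite /psi; case: eqP => [->|_]; last by rewrite mulrAC.
by rewrite lt0n mbv !mulr1.
Qed.

(** The summand of slice [v] in the rate's denominator cancels against N^v and leaves the second
    moment of N_b^v. The remaining summands involve other slices only, so they factor out of the
    mean of N_b^v N^v and are evaluated by [mean_fraction]. *)
Lemma total_delay_SCPF b v :
  ('E_P[total_delay (rateSCPF s) b v] =
   delta C b v * (rho b v * (rho b v + 1) +
     rho b v * (overall_load rho v + 1) *
     \sum_(w | w != v) s w / s v *
       (relative_load rho b w * (1 - expR (- overall_load rho w))))%:E)%E.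
Proof.
rewrite (mean_total_delay M _ (fun n => (slice_count n v)%:R / s v *
  \sum_(w | (0 < slice_count n w)%N) (n b w)%:R * s w / (slice_count n w)%:R)) //;
  last 2 first.
- move=> n; rewrite mulr_ge0 ?divr_ge0 // sumr_ge0 // => w _.
  by rewrite divr_ge0 // mulr_ge0.
- by move=> n c; rewrite /rateSCPF !invfM !invrK [in RHS](mulrC _ (s v)^-1).
congr (_ * _)%E.
pose tot w m := total_count (slice_set w) m.
pose psi w (m : {ffun B * V -> nat}) : R := (m (b, w))%:R / (tot w m)%:R.
pose phi m := \sum_(w | w != v) s w / s v * psi w m.
have psi0 w m : 0 <= psi w m by rewrite divr_ge0.
have c0 w : 0 <= s w / s v by rewrite divr_ge0.
have phi0 m : 0 <= phi m by apply: sumr_ge0 => w _; rewrite mulr_ge0.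
have phi_incr k m : k \in slice_set v -> phi (incr k m) = phi m.
  rewrite inE => /eqP kv; apply: eq_bigr => w wv; congr (_ * _).
  have kw : (k.2 == w) = false by rewrite kv eq_sym (negbTE wv).
  rewrite /psi /tot total_count_incr ffunE inE kw addn0.
  suff -> : ((b, w) == k) = false by rewrite addn0.
  by apply/eqP => e; rewrite -e eqxx in kw.
have sum_rhop w : \sum_(k in slice_set w) rhop k = overall_load rho w.
  exact: sum_slice_set.
have mean_phi : Ex phi = (\sum_(w | w != v) s w / s v *
    (relative_load rho b w * (1 - expR (- overall_load rho w))))%:E.
  apply: (mean_lincomb mN) => // w _.
  rewrite (mean_fraction rhop_ge0 mN lawN) ?inE // ?sum_rhop //.
rewrite (mean_ext _ (fun m => (m (b, v))%:R * ((m (b, v))%:R * 1) +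
   (m (b, v))%:R * ((tot v m)%:R * phi m))); last first.
  move=> m; rewrite -mulrDr mulr1.
  have totE w : slice_count (fun b v => m (b, v)) w = tot w m.
    by rewrite /tot total_count_slice_set.
  under eq_bigr do rewrite totE.
  under eq_bigl do rewrite totE.
  rewrite totE.
  (* If N_b^v is 0 both sides vanish; otherwise N^v is positive, so the summand of slice [v] is
     present and N^v can be cancelled. *)
  have [->|mbv] := eqVneq (m (b, v)) 0%N; first by rewrite !mul0r.
  have totv : tot v m != 0%N.
    apply: contra mbv; rewrite sum_nat_eq0 => /forall_inP/(_ (b, v)).
    by apply; rewrite inE.
  congr (_ * _); rewrite (bigD1 v) ?lt0n //= mulrDr; congr (_ + _).
    by field; rewrite pnatr_eq0 totv s_neq0.
  rewrite -[LHS]mulrA; congr (_ * _).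
  rewrite /phi mulr_sumr big_mkcond [in RHS]big_mkcond; apply: eq_bigr => w _.
  rewrite lt0n; case: (eqVneq w v) => _; rewrite ?andbF // andbT.
  (* An empty slice is excluded from the sum on the left; on the right its fraction is 0 because the
     inverse of 0 is 0. *)
  case: eqP => [t0|_] /=; last by rewrite /psi; ring.
  by rewrite /psi t0 invr0 !mulr0.
rewrite (meanD mN) => [|m|m]; last 2 first.
- by rewrite mulr1 mulr_ge0.
- by rewrite !mulr_ge0.
rewrite (mean_count_sqr rhop_ge0 mN lawN) // mean1 mule1.
by rewrite (mean_count_tot rhop_ge0 mN lawN) ?inE // mean_phi sum_rhop -EFinM.
Qed.

(** The normalization cancels [delta], which is finite and nonzero, and the computation leaves the
    extended reals. *)
Lemma overall_btdE (r : policy R B V) (X : B -> V -> R) :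
  (forall b v, 'E_P[total_delay r b v] = delta C b v * (X b v)%:E)%E ->
  overall_btd s M r = (\sum_v s v * \sum_b relative_load rho b v *
    (s v / overall_load rho v * ((rho b v)^-1 * X b v)))%:E.
Proof.
move=> EX; rewrite /overall_btd -sumEFin; apply: eq_bigr => v _.
rewrite EFinM; congr (_ * _)%E; rewrite /normalized_btd_slice -sumEFin.
apply: eq_bigr => b _; rewrite [in RHS]EFinM; congr (_ * _)%E.
rewrite /normalized_btd /mean_btd EX.
have dfin : delta C b v \is a fin_num by rewrite ge0_fin_numE // ltW.
have d0 : fine (delta C b v) != 0 by rewrite fine_eq0 // gt_eqF.
rewrite -(fineK dfin) inver (negbTE d0) -!EFinM; congr EFin.
rewrite [RHS](_ : _ = (fine (delta C b v))^-1 * fine (delta C b v) *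
  (s v / overall_load rho v * ((rho b v)^-1 * X b v))).
  by ring.
by rewrite mulVf ?mul1r.
Qed.

End PolicyMeans.

(** * Closed forms of the overall BTDs *)

Section OverallBTD.
Context {R : realType} {B V : finType} {s : V -> R} {rho : B -> V -> R}.
Context {C : B -> V -> probability (measurableTypeR R) R}.
Context (s_gt0 : forall v, 0 < s v).
Context (s_sum1 : \sum_v s v = 1).
Context (delta_gt0 : forall b v, (0 < delta C b v)%E).
Context (delta_fin : forall b v, (delta C b v < +oo)%E).
Context (rho_ge0 : forall b v, 0 <= rho b v).
Context (load_gt0 : forall v, 0 < overall_load rho v).
Context (M : slicing_model rho C).

Local Notation load := (overall_load rho).
Local Notation rhot := (relative_load rho).

Let s_neq0 v : s v != 0. Proof. exact: lt0r_neq0. Qed.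
Let load_neq0 v : load v != 0. Proof. exact: lt0r_neq0. Qed.

(** At a station without load the weight [rhot b v] kills both sides of the formulas below;
    elsewhere one may divide by [rho b v]. *)
Let rhot0 b v : rho b v = 0 -> rhot b v = 0.
Proof. by rewrite /relative_load => ->; rewrite mul0r. Qed.

(** Dividing [rho b v + 1] by the overall load gives the relative load plus the inverse of the
    overall load, a correction that fades in heavy traffic. *)
Lemma overall_btd_SS :
  overall_btd s M (rateSS s) =
  (\sum_v s v * \sum_b rhot b v * (rhot b v + (load v)^-1))%:E.
Proof.
rewrite (overall_btdE delta_gt0 delta_fin _ _ _
  (total_delay_SS s_gt0 delta_gt0 delta_fin rho_ge0 M)).
congr EFin; apply: eq_bigr => v _; congr (_ * _); apply: eq_bigr => b _.
have [/rhot0 ->|r0] := eqVneq (rho b v) 0; first by rewrite !mul0r.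
by congr (_ * _); rewrite /relative_load; field; rewrite s_neq0 load_neq0 r0.
Qed.

Lemma overall_btd_GPS :
  overall_btd s M (rateGPS s) =
  (\sum_v s v * \sum_b rhot b v * ((rhot b v + (load v)^-1) * (1 - sbar s rho b v)))%:E.
Proof.
rewrite (overall_btdE delta_gt0 delta_fin _ _ _
  (total_delay_GPS s_gt0 s_sum1 delta_gt0 delta_fin rho_ge0 M)).
congr EFin; apply: eq_bigr => v _; congr (_ * _); apply: eq_bigr => b _.
have [/rhot0 ->|r0] := eqVneq (rho b v) 0; first by rewrite !mul0r.
by congr (_ * _); rewrite /relative_load; field; rewrite s_neq0 load_neq0 r0.
Qed.

Lemma overall_btd_SCPF :
  overall_btd s M (rateSCPF s) =
  (\sum_v s v * \sum_b rhot b v * (s v * (rhot b v + (load v)^-1) +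
    (1 + (load v)^-1) *
      \sum_(w | w != v) s w * (rhot b w * (1 - expR (- load w)))))%:E.
Proof.
rewrite (overall_btdE delta_gt0 delta_fin _ _ _
  (total_delay_SCPF s_gt0 delta_gt0 delta_fin rho_ge0 load_gt0 M)).
congr EFin; apply: eq_bigr => v _; congr (_ * _); apply: eq_bigr => b _.
have [/rhot0 ->|r0] := eqVneq (rho b v) 0; first by rewrite !mul0r.
congr (_ * _).
rewrite (_ : \sum_(w | w != v) s w / s v * _ =
  (s v)^-1 * \sum_(w | w != v) s w * (rhot b w * (1 - expR (- load w)))); last first.
  by rewrite mulr_sumr; apply: eq_bigr => w _; rewrite [RHS]mulrA [_^-1 * _]mulrC.
set S := \sum_(w | _) _; rewrite /relative_load.
by field; rewrite s_neq0 load_neq0 r0.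
Qed.

End OverallBTD.

(** * Weighted Cauchy-Schwarz inequalities *)

Section Inequalities.
Context {R : realFieldType} {V : finType}.
Implicit Types p x c : V -> R.

(** Lagrange's identity: twice the gap between the two sides is the double sum of
    [p v * p w * (x v - x w) ^+ 2]. *)
Lemma sqr_sum_le p x : (forall v, 0 <= p v) ->
  (\sum_v p v * x v) ^+ 2 <= (\sum_v p v) * \sum_v p v * x v ^+ 2.
Proof.
move=> p0; set A := \sum_v p v; set m := \sum_v p v * x v.
set q := \sum_v p v * x v ^+ 2.
have : 0 <= \sum_v \sum_w p v * p w * (x v - x w) ^+ 2.
  apply: sumr_ge0 => v _; apply: sumr_ge0 => w _.
  by apply: mulr_ge0; [exact: mulr_ge0 | exact: sqr_ge0].
rewrite (_ : \sum_v _ = 2 * (A * q - m ^+ 2)).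
  by rewrite pmulr_rge0 ?ltr0n // subr_ge0.
transitivity (\sum_v (p v * x v ^+ 2 * A - 2 * (p v * x v * m) + p v * q)).
  apply: eq_bigr => v _; rewrite [_ * A]mulr_sumr [p v * x v * m]mulr_sumr.
  rewrite [p v * q]mulr_sumr mulr_sumr -sumrB -big_split /=.
  by apply: eq_bigr => w _; ring.
rewrite big_split sumrB /= -!mulr_suml -mulr_sumr -mulr_suml -/q -/m -/A; ring.
Qed.

(** Only the weights on the support of [x] matter on the left, so Cauchy-Schwarz is applied to them
    alone; their total is at most [c v] wherever [x v] is nonzero. *)
Lemma sqr_sum_le_support p x c : (forall v, 0 <= p v) ->
  (forall v, x v != 0 -> \sum_(w | x w != 0) p w <= c v) ->
  (\sum_v p v * x v) ^+ 2 <= \sum_v p v * (x v ^+ 2 * c v).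
Proof.
move=> p0 pc; pose p' v := if x v != 0 then p v else 0.
have p'0 v : 0 <= p' v by rewrite /p'; case: ifP.
have -> : \sum_v p v * x v = \sum_v p' v * x v.
  by apply: eq_bigr => v _; rewrite /p'; case: eqP => //= ->; rewrite !mulr0.
apply: le_trans (sqr_sum_le _ _ p'0) _; rewrite mulr_sumr ler_sum // => v _.
rewrite /p'; case: eqVneq => [->|xv]; first by rewrite expr0n /= !(mul0r, mulr0).
rewrite mulrC -mulrA ler_wpM2l // ler_wpM2l ?sqr_ge0 //.
by rewrite -big_mkcond pc.
Qed.

End Inequalities.

(** * The limiting gains and their lower bounds *)

Lemma sqnormM_diagv (R : realType) (B : finType) (y x : B -> R) :
  sqnormM (1%:M - diagv y) x = \sum_b x b ^+ 2 * (1 - y b).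
Proof.
rewrite /sqnormM mulmxBr mulmx1 mulmxBl /diagv mul_mx_diag !mxE -sumrB.
rewrite [RHS](big_enum_val (A := B)) /=.
by apply: eq_bigr => i _; rewrite !mxE; ring.
Qed.

(** As the overall load of [w] grows, [expR (- rho b w)] stays at 1 if the relative load at [b] is 0
    and tends to 0 otherwise; hence the indicator. *)
Definition sbar_lim {R : realType} {B V : finType} (s : V -> R)
    (rhot : B -> V -> R) (b : B) (v : V) : R :=
  \sum_(w | w != v) s w * (rhot b w == 0)%:R.

Section HeavyTrafficGains.
Context {R : realType} {B V : finType} {s : V -> R} {rhot : B -> V -> R}.
Context (s_gt0 : forall v, 0 < s v).
Context (s_sum1 : \sum_v s v = 1).
Context (rhot_sum1 : forall v, \sum_b rhot b v = 1).

Lemma scpf_btdE :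
  \sum_v s v * inner (gtilde s rhot) (rhot ^~ v) = \sum_b gtilde s rhot b ^+ 2.
Proof.
under eq_bigr do rewrite mulr_sumr.
rewrite exchange_big; apply: eq_bigr => b _ /=.
rewrite expr2 [in X in _ = _ * X]/gtilde mulr_sumr.
by apply: eq_bigr => v _; ring.
Qed.

(** A zero sum of squares would make every [gtilde] zero, whereas they add up to 1. *)
Lemma scpf_btd_gt0 : 0 < \sum_v s v * inner (gtilde s rhot) (rhot ^~ v).
Proof.
rewrite scpf_btdE lt_neqAle sumr_ge0 ?andbT => [|b _]; last exact: sqr_ge0.
apply/eqP => /esym/eqP; rewrite psumr_eq0 => [/allP g0|b _]; last exact: sqr_ge0.
have : \sum_b gtilde s rhot b = 0.
  by apply: big1 => b _; apply/eqP; have := g0 b (mem_index_enum b); rewrite sqrf_eq0.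
rewrite exchange_big /=; under eq_bigr do rewrite -mulr_sumr rhot_sum1 mulr1.
by rewrite s_sum1 => /eqP; rewrite oner_eq0.
Qed.

Lemma gain_SS_H_ge1 : 1 <= gain_SS_H s rhot.
Proof.
rewrite ler_pdivlMr ?scpf_btd_gt0 // mul1r scpf_btdE.
under [leRHS]eq_bigr do rewrite mulr_sumr.
rewrite exchange_big ler_sum // => b _.
have := @sqr_sum_le_support _ _ s (rhot b) (fun=> 1).
under [X in _ -> _ -> _ <= X]eq_bigr do rewrite mulr1.
apply => [v|v _]; first exact: ltW.
rewrite -s_sum1 big_mkcond ler_sum // => w _; case: ifP => // _; exact: ltW.
Qed.

Lemma gain_GPS_HE (y : B -> V -> R) :
  gain_GPS_H s rhot y =
  (\sum_v s v * \sum_b rhot b v ^+ 2 * (1 - y b v)) /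
  \sum_v s v * inner (gtilde s rhot) (rhot ^~ v).
Proof.
by congr (_ / _); apply: eq_bigr => v _; rewrite sqnormM_diagv.
Qed.

Lemma gain_GPS_H_ge1 : 1 <= gain_GPS_H s rhot (sbar_lim s rhot).
Proof.
rewrite gain_GPS_HE ler_pdivlMr ?scpf_btd_gt0 // mul1r scpf_btdE.
under [leRHS]eq_bigr do rewrite mulr_sumr.
rewrite exchange_big ler_sum // => b _ /=.
apply: sqr_sum_le_support => [v|v xv]; first exact: ltW.
(* The total share 1 splits into slices present at [b] and absent ones; [sbar_lim] collects shares
   of absent ones only. *)
rewrite /sbar_lim lerBrDr -[leRHS]s_sum1 [leRHS](bigID (fun w => rhot b w != 0)) /=.
rewrite lerD2l [leRHS]big_mkcond [leLHS]big_mkcond ler_sum // => w _.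
have := s_gt0 w; case: (rhot b w == 0); case: (w != v) => /= /ltW sw;
  by rewrite ?mulr1 ?mulr0.
Qed.

End HeavyTrafficGains.

(** * Limits along a filter *)

Section Limits.
Context {R : realType} {I : Type} {F : set_system I} {FF : Filter F}.

Lemma cvg_sumr (K : finType) (Q : pred K) (f : K -> I -> R) (l : K -> R) :
  (forall k, Q k -> f k i @[i --> F] --> l k) ->
  \sum_(k | Q k) f k i @[i --> F] --> \sum_(k | Q k) l k.
Proof. by move=> fl; apply: cvg_big => //; exact: add_continuous. Qed.

Lemma cvg_expRN_scale (c : R) (f : I -> R) : 0 <= c ->
  f i @[i --> F] --> +oo -> expR (- (c * f i)) @[i --> F] --> ((c == 0)%:R : R).
Proof.
rewrite le_eqVlt => /predU1P[<-|c0] foo.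
  rewrite eqxx; under eq_fun do rewrite mul0r oppr0 expR0; exact: cvg_cst.
rewrite gt_eqF //; apply: (cvg_comp (fun i => c * f i) (fun x => expR (- x))).
  2: exact: cvgr_expR.
apply/cvgryPgt => A; have /cvgryPgt/(_ (A / c)) := foo.
by apply: filterS => i; rewrite ltr_pdivrMr // mulrC.
Qed.

(** The extended quotient is the real one where [g] is nonzero, which holds eventually since its
    limit is positive. *)
Lemma cvg_EFin_div (f g : I -> R) (a b : R) : 0 < b ->
  f i @[i --> F] --> a -> g i @[i --> F] --> b ->
  ((f i)%:E / (g i)%:E)%E @[i --> F] --> (a / b)%:E.
Proof.
move=> b0 fa gb.
have gpos : \forall i \near F, 0 < g i by exact: cvgr_gt gb _ b0.
have E : \forall i \near F, ((f i)%:E / (g i)%:E = (f i / g i)%:E)%E.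
  by apply: filterS gpos => i gi; rewrite inver gt_eqF.
apply: cvg_EFin; first by apply: filterS E => i ->.
apply: (cvg_trans (near_eq_cvg (f := fun i => f i / g i) _)).
  by apply: filterS E => i /= ->.
by apply: cvgM => //; apply: cvgV => //; rewrite gt_eqF.
Qed.

End Limits.

(** * Passage to heavy traffic *)

Theorem corollary3 (R : realType) (B V : finType)
    (hB : (0 < #|B|)%N) (hV : (0 < #|V|)%N)
    (s : V -> R) (s_gt0 : forall v, 0 < s v) (s_sum1 : \sum_v s v = 1)
    (C : B -> V -> probability (measurableTypeR R) R)
    (delta_gt0 : forall b v, (0 < delta C b v)%E)
    (delta_fin : forall b v, (delta C b v < +oo)%E)
    (rhot : B -> V -> R)
    (I : Type) (F : set_system I) (FF : ProperFilter F)
    (rho : I -> B -> V -> R)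
    (rho_ge0 : forall i b v, 0 <= rho i b v)
    (load_gt0 : forall i v, 0 < overall_load (rho i) v)
    (rhot_fixed : forall i b v, relative_load (rho i) b v = rhot b v)
    (load_pinfty : forall v, overall_load (rho i) v @[i --> F] --> +oo)
    (M : forall i, slicing_model (rho i) C) :
  let sbarH := fun b v => lim (sbar s (rho i) b v @[i --> F]) in
  [/\ forall b v, cvg (sbar s (rho i) b v @[i --> F]),
      gain_SS s (M i) @[i --> F] --> (gain_SS_H s rhot)%:E,
      gain_GPS s (M i) @[i --> F] --> (gain_GPS_H s rhot sbarH)%:E,
      1 <= gain_SS_H s rhot
    & 1 <= gain_GPS_H s rhot sbarH].
Proof.
move=> sbarH.
(* A proper filter lives on an inhabited type; the sign and normalization of [rhot] are read off at
   this index. *)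
have [i0 _] : exists i : I, True by have [i] := filter_ex (filterT (F := F)); exists i.
have load_neq0 i v : overall_load (rho i) v != 0 by exact: lt0r_neq0.
have rhot_ge0 b v : 0 <= rhot b v.
  by rewrite -(rhot_fixed i0) divr_ge0 // ltW.
have rhot_sum1 v : \sum_b rhot b v = 1.
  under eq_bigr do rewrite -(rhot_fixed i0); rewrite -mulr_suml.
  exact: divff (load_neq0 i0 v).
have rhoE i b v : rho i b v = rhot b v * overall_load (rho i) v.
  by rewrite -(rhot_fixed i) divfK.
have sbar_cvg b v : sbar s (rho i) b v @[i --> F] --> sbar_lim s rhot b v.
  apply: cvg_sumr => w _; apply: cvgM; first exact: cvg_cst.
  by under eq_fun do rewrite rhoE; exact: cvg_expRN_scale.
have sbarHE : sbarH = sbar_lim s rhot.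
  by apply/funext => b; apply/funext => v; exact: cvg_lim (sbar_cvg b v).
have inv_cvg v : (overall_load (rho i) v)^-1 @[i --> F] --> (0 : R).
  by apply/gtr0_cvgV0 => //; exact: nearW.
have exp_cvg v : expR (- overall_load (rho i) v) @[i --> F] --> (0 : R).
  exact: (cvg_comp _ _ (load_pinfty v) (@cvgr_expR R)).
have SCPF_cvg : \sum_v s v * (\sum_b rhot b v *
      (s v * (rhot b v + (overall_load (rho i) v)^-1) +
    (1 + (overall_load (rho i) v)^-1) *
      \sum_(w | w != v) s w * (rhot b w * (1 - expR (- overall_load (rho i) w)))))
    @[i --> F] --> \sum_v s v * inner (gtilde s rhot) (rhot ^~ v).
  apply: cvg_sumr => v _; apply: cvgM; first exact: cvg_cst.
  apply: cvg_sumr => b _. rewrite [gtilde _ _ _ * _]mulrC.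
  apply: cvgM; first exact: cvg_cst.
  (* The term of slice [v] is split off [gtilde] to match the closed form, where it arises from the
     second moment rather than from a fraction. *)
  rewrite /gtilde (bigD1 v) //=; apply: cvgD.
    apply: cvgM; first exact: cvg_cst.
    by rewrite -[X in _ --> X]addr0; apply: cvgD => //; exact: cvg_cst.
  rewrite -[X in _ --> X]mul1r; apply: cvgM.
    by rewrite -[X in _ --> X]addr0; apply: cvgD => //; exact: cvg_cst.
  apply: cvg_sumr => w _; apply: cvgM; first exact: cvg_cst.
  rewrite -[X in _ --> X]mulr1; apply: cvgM; first exact: cvg_cst.
  by rewrite -[X in _ --> X]subr0; apply: cvgB => //; exact: cvg_cst.
have lin_cvg b v : rhot b v + (overall_load (rho i) v)^-1 @[i --> F] --> rhot b v.
  by rewrite -[X in _ --> X]addr0; apply: cvgD => //; exact: cvg_cst.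
have SS_cvg : \sum_v s v * (\sum_b rhot b v *
      (rhot b v + (overall_load (rho i) v)^-1))
    @[i --> F] --> \sum_v s v * sqnorm2 (rhot ^~ v).
  apply: cvg_sumr => v _; apply: cvgM; first exact: cvg_cst.
  by apply: cvg_sumr => b _; rewrite expr2; apply: cvgM => //; exact: cvg_cst.
have GPS_cvg : \sum_v s v * (\sum_b rhot b v *
      ((rhot b v + (overall_load (rho i) v)^-1) * (1 - sbar s (rho i) b v)))
    @[i --> F] --> \sum_v s v * (\sum_b rhot b v ^+ 2 *
      (1 - sbar_lim s rhot b v)).
  apply: cvg_sumr => v _; apply: cvgM; first exact: cvg_cst.
  apply: cvg_sumr => b _; rewrite expr2 -mulrA; apply: cvgM; first exact: cvg_cst.
  by apply: cvgM => //; apply: cvgB => //; exact: cvg_cst.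
have btd_gt0 := scpf_btd_gt0 s_sum1 rhot_sum1.
have SCPFE i := overall_btd_SCPF s_gt0 delta_gt0 delta_fin
  (rho_ge0 i) (load_gt0 i) (M i).
have SSE i := overall_btd_SS s_gt0 delta_gt0 delta_fin
  (rho_ge0 i) (load_gt0 i) (M i).
have GPSE i := overall_btd_GPS s_gt0 s_sum1 delta_gt0 delta_fin
  (rho_ge0 i) (load_gt0 i) (M i).
have rhotE i : relative_load (rho i) = rhot.
  by apply/funext => b; apply/funext => v.
split.
- by move=> b v; apply/cvg_ex; exists (sbar_lim s rhot b v).
- rewrite /gain_SS; under eq_fun do rewrite SSE SCPFE rhotE.
  exact: cvg_EFin_div.
- rewrite sbarHE gain_GPS_HE /gain_GPS; under eq_fun do rewrite GPSE SCPFE rhotE.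
  exact: cvg_EFin_div.
- exact: gain_SS_H_ge1.
- by rewrite sbarHE; exact: gain_GPS_H_ge1.
Qed.
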